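(* Let $G$ be a finite abelian group (written additively) and let $\mathcal{F}: G^{\mathbb{Z}}\to G^{\mathbb{Z}}$ be an injective group cellular automaton on $G$. Let $\mathcal{H}=\mathcal{F}-\mathcal{F}^{-1}$ be the group cellular automaton on $G$ defined by $\mathcal{H}(c)=\mathcal{F}(c)-\mathcal{F}^{-1}(c)$ for every $c\in G^{\mathbb{Z}}$. Then $\mathcal{F}$ is expansive if and only if $\mathcal{H}$ is positively expansive.
   Context: For a finite group $G$, $G^{\mathbb{Z}}$ is a group under the componentwise operation, with the product topology of the discrete topologies on the factors; this topology is induced by the metric $d(c,c')=0$ if $c=c'$ and $d(c,c')=2^{-\min\{|j|:\ c_j\neq c'_j\}}$ otherwise. A group cellular automaton (GCA) on $G$ is a continuous group endomorphism $\mathcal{F}:G^{\mathbb{Z}}\to G^{\mathbb{Z}}$ commuting with the shift $\sigma$, $\sigma(c)_i=c_{i+1}$. An injective GCA is bijective and its inverse is again a GCA. An injective GCA $\mathcal{F}$ is expansive if there is $\epsilon>0$ such that for any two distinct $c,c'\in G^{\mathbb{Z}}$ there is $n\in\mathbb{Z}$ with $d(\mathcal{F}^n(c),\mathcal{F}^n(c'))>\epsilon$. A (possibly non-injective) GCA $\mathcal{F}$ is positively expansive if there is $\epsilon>0$ such that for any two distinct $c,c'\in G^{\mathbb{Z}}$ there is an integer $n\ge 0$ with $d(\mathcal{F}^n(c),\mathcal{F}^n(c'))>\epsilon$. *)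

(* Defs.v *)
From HB Require Import structures.
From mathcomp Require Import all_boot all_order all_algebra.
From mathcomp Require Import all_classical all_reals all_analysis.

Set Implicit Arguments.
Unset Strict Implicit.
Unset Printing Implicit Defensive.

Import Order.TTheory GRing.Theory Num.Theory.

Local Open Scope classical_set_scope.
Local Open Scope ring_scope.

Definition config (G : finZmodType) : Type :=
  {ptws int -> discrete_topology G}.

HB.instance Definition _ (G : finZmodType) :=
  Topological.copy (config G) {ptws int -> discrete_topology G}.
HB.instance Definition _ (G : finZmodType) :=
  GRing.Zmodule.copy (config G) (int -> G).

Definition shift (G : finZmodType) (c : config G) : config G :=
  fun i => c (i + 1).

Record gca (G : finZmodType) := GCA {
  gca_map :> {additive config G -> config G};
  gca_continuous : continuous gca_map;
  gca_shift : forall c, gca_map (shift c) = shift (gca_map c) }.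

Section GCAOperations.
Variable G : finZmodType.
Implicit Types (c : config G).

Lemma cvg_configP (H : set_system (config G)) (c : config G) :
  Filter H -> H --> c <-> forall i, \forall c' \near H, c' i = c i.
Proof.
move=> FH; have HP := @pointwise_cvgP (discrete_topology int) (discrete_topology G) H c FH.
split=> [/HP Hc i|Hc]; first by have /discrete_cvg := Hc i; apply.
by apply/HP => i; apply/discrete_cvg; exact: Hc.
Qed.

Lemma continuous_configP (T : topologicalType) (f : T -> config G) :
  continuous f <-> forall x i, \forall y \near x, f y i = f x i.
Proof.
split=> fc x.
  exact: (@cvg_configP (f @ x) (f x) _).1 (fc x).
exact: (@cvg_configP (f @ x) (f x) _).2 (fc x).
Qed.

Lemma config_compact : compact [set: config G].
Proof.
have := @tychonoff int (fun=> discrete_topology G) (fun=> setT).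
move=> /(_ (fun=> @finite_compact (discrete_topology G) setT
  (@finite_finset G setT))).
by congr (compact _); apply/seteqP; split.
Qed.

Lemma config_hausdorff : hausdorff_space (config G).
Proof.
by apply: (@hausdorff_product int (fun=> discrete_topology G)) => _;
  exact: discrete_hausdorff.
Qed.

Section Inverse.
Variables (F : gca G) (Finj : injective F).

Lemma gca_closed_image (A : set (config G)) : closed A -> closed (F @` A).
Proof.
move=> Acl; apply: (compact_closed config_hausdorff).
apply: continuous_compact; last first.
  by apply: (subclosed_compact Acl config_compact).
exact/continuous_subspaceT/gca_continuous.
Qed.

Lemma gca_shiftn p c : F (fun i => c (i + p%:Z)) = (fun i => F c (i + p%:Z)).
Proof.
have sE k c' : iter k (@shift G) c' = (fun i => c' (i + k%:Z)).
  elim: k => [|k IH] /=; apply/funext => i; first by rewrite addr0.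
  by rewrite IH /shift -addrA -intS.
rewrite -sE -[RHS]sE; elim: p => //= p IH.
by rewrite gca_shift IH.
Qed.

Let per n (f : {ffun 'I_n.+1 -> G}) : config G :=
  fun i => f (inord `|(i %% n.+1%:Z)%Z|).

Let per_image n (f : {ffun 'I_n.+1 -> G}) :
  exists c, F c = per f.
Proof.
pose g (h : {ffun 'I_n.+1 -> G}) : {ffun 'I_n.+1 -> G} :=
  [ffun j : 'I_n.+1 => F (per h) j%:Z : G].
have perD (f' : {ffun 'I_n.+1 -> G}) (i : int) k : per f' (i + k%:Z * n.+1%:Z) = per f' i.
  by rewrite /per [i + _]addrC modzMDl.
have FperE f' : F (per f') = per (g f').
  have FD i : F (per f') (i + n.+1%:Z) = F (per f') i.
    rewrite -[LHS](congr1 (fun c => c i) (gca_shiftn n.+1 (per f'))).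
    congr (F _ i); apply/funext => j.
    by have := perD f' j 1%N; rewrite mul1r.
  have FM i k : F (per f') (i + k%:Z * n.+1%:Z) = F (per f') i.
    elim: k => [|k IH]; first by rewrite mul0r addr0.
    by rewrite intS mulrDl mul1r [_ + k%:Z * _]addrC addrA FD IH.
  have FMz i (k : int) : F (per f') (i + k * n.+1%:Z) = F (per f') i.
    case: k => k; first exact: FM.
    by rewrite NegzE -[LHS](FM _ k.+1) -addrA -mulrDl addNr mul0r addr0.
  apply/funext => i; rewrite [RHS]/per ffunE.
  have r0 : (0 <= i %% n.+1%:Z)%Z by exact: modz_ge0.
  rewrite inordK; last first.
    by rewrite -ltz_nat gez0_abs// ltz_pmod.
  rewrite gez0_abs// -[LHS](FMz _ (- (i %/ n.+1%:Z)%Z)); congr (F _ _).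
  by rewrite {1}(divz_eq i n.+1%:Z) mulNr addrAC subrr add0r.
have per_inj : injective (@per n).
  move=> f1 f2 /(congr1 (fun c => fun j : 'I_n.+1 => c j%:Z)) e.
  apply/ffunP => j; have := congr1 (fun h => h j) e.
  by rewrite /per /= modz_small ?absz_nat ?inord_val ?ltz_nat ?ltn_ord.
have g_inj : injective g.
  by move=> f1 f2 e; apply/per_inj/Finj; rewrite !FperE e.
exists (per (invF g_inj f)).
by rewrite FperE f_invF.
Qed.

(* Periodic configurations are dense and lie in the image of F, which permutes
   the finitely many configurations of a given period; the image is closed by
   compactness. *)
Lemma gca_surj c : exists c', F c' = c.
Proof.
pose u n : config G := per [ffun j : 'I_(n.*2).+1 => c (j%:Z - n%:Z)].
pose v n : config G := fun i => u n (i + n%:Z).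
have vn n i : (`|i| <= n)%N -> v n i = c i.
  move=> ile; rewrite /v /u /per ffunE.
  have [i0 i1] : (0 <= i + n%:Z)%R /\ (i + n%:Z < n.*2.+1%:Z)%R.
    move: ile; rewrite -lez_nat abszE ler_norml => /andP[i0 i1]; split.
      by rewrite -lerBlDr sub0r.
    by rewrite -addn1 -addnn !PoszD ltzD1 lerD2r.
  rewrite modz_small ?i0 ?i1// inordK; last by rewrite -ltz_nat gez0_abs.
  by rewrite gez0_abs// addrK.
have vF n : (F @` setT) (v n).
  have [w Fw] := per_image [ffun j : 'I_(n.*2).+1 => c (j%:Z - n%:Z)].
  by exists (fun i => w (i + n%:Z)); rewrite // gca_shiftn Fw.
have vc : v @ \oo --> c.
  apply/cvg_configP => i.
  suff: \forall n \near \oo, v n i = c i by [].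
  by near=> n; apply: vn; near: n; exact: nbhs_infty_ge.
have [c' _ <-] : (F @` setT) c; last by exists c'.
apply: (closed_cvg _ (gca_closed_image closedT) _ _ vc).
by apply: nearW => n; exact: vF.
Unshelve. all: by end_near. Qed.

Definition gca_inv_map (c : config G) : config G := projT1 (cid (gca_surj c)).

Lemma gca_invK : cancel gca_inv_map F.
Proof. by move=> c; rewrite /gca_inv_map; case: cid. Qed.

Lemma gcaK : cancel F gca_inv_map.
Proof. by move=> c; apply: Finj; rewrite gca_invK. Qed.

Fact gca_inv_is_zmod_morphism : zmod_morphism gca_inv_map.
Proof. by move=> c c'; apply: Finj; rewrite raddfB !gca_invK. Qed.

HB.instance Definition _ :=
  GRing.isZmodMorphism.Build (config G) (config G) gca_inv_map
    gca_inv_is_zmod_morphism.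

Fact gca_inv_continuous : continuous gca_inv_map.
Proof.
apply/continuous_closedP => A /gca_closed_image; congr closed.
apply/seteqP; split=> [_ [c Ac <-]|c Ac] /=; first by rewrite gcaK.
by exists (gca_inv_map c); rewrite ?gca_invK.
Qed.

Fact gca_inv_shift c : gca_inv_map (shift c) = shift (gca_inv_map c).
Proof. by apply: Finj; rewrite gca_shift !gca_invK. Qed.

Definition gca_inv : gca G := GCA gca_inv_continuous gca_inv_shift.

(* Negz k stands for the integer - (k + 1). *)
Definition gca_iterz (n : int) (c : config G) : config G :=
  match n with
  | Posz k => iter k F c
  | Negz k => iter k.+1 gca_inv c
  end.

End Inverse.

Fact gca_sub_continuous (F F' : gca G) : continuous (F \- F').
Proof.
apply/continuous_configP => c i.
have Fi := (continuous_configP F).1 (@gca_continuous _ F) c i.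
have F'i := (continuous_configP F').1 (@gca_continuous _ F') c i.
by near=> y; rewrite /= !fctE; congr (_ - _); near: y.
Unshelve. all: by end_near. Qed.

Fact gca_sub_shift (F F' : gca G) c :
  (F \- F') (shift c) = shift ((F \- F') c).
Proof. by rewrite /= !gca_shift. Qed.

Definition gca_sub (F F' : gca G) : gca G :=
  @GCA G (F \- F') (@gca_sub_continuous F F') (@gca_sub_shift F F').

Lemma gca_subE (F F' : gca G) : gca_sub F F' =1 F \- F'.
Proof. by []. Qed.

End GCAOperations.

Section Expansivity.
Variables (R : realType) (G : finZmodType).

Lemma config_neq_ex (c c' : config G) : c <> c' ->
  exists n : nat, `[< exists2 j : int, `|j|%N = n & c j != c' j >].
Proof.
move=> cc'; apply: contrapT => H; apply: cc'; apply/funext => j.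
apply: contrapT => /eqP cj; apply: H; exists `|j|%N.
by apply/asboolP; exists j.
Qed.

Definition config_dist (c c' : config G) : R :=
  match pselect (c = c') with
  | left _ => 0
  | right cc' => 2 ^- ex_minn (config_neq_ex cc')
  end.

Definition expansive (F : gca G) (Finj : injective F) : Prop :=
  exists2 eps : R, 0 < eps & forall c c' : config G, c <> c' ->
    exists n : int,
      config_dist (gca_iterz Finj n c) (gca_iterz Finj n c') > eps.

Definition positively_expansive (F : gca G) : Prop :=
  exists2 eps : R, 0 < eps & forall c c' : config G, c <> c' ->
    exists n : nat, config_dist (iter n F c) (iter n F c') > eps.

End Expansivity.

(* Main.v *)
Require Import Defs.
From mathcomp Require Import all_boot all_order all_algebra.
From mathcomp Require Import all_classical all_reals all_analysis.

(** Since H = F - F^-1, we have F = H + F^-1 and F^-2 = 1 - H F^-1, so the ring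
    Z[F, F^-1] is generated as a Z[H]-module by 1 and F^-1.  Hence if the
    H-orbits of c and of F^-1 c both vanish on a window, so does the two-sided
    F-orbit of c, and conversely.  By continuity of F^-1 the vanishing of the
    H-orbit of c on a larger window controls that of F^-1 c. *)

Set Implicit Arguments.
Unset Strict Implicit.
Unset Printing Implicit Defensive.

Import Order.TTheory GRing.Theory Num.Theory.

Local Open Scope classical_set_scope.
Local Open Scope ring_scope.

Section Windows.
Variable G : finZmodType.
Implicit Types (c : config G) (m : nat).

Definition vanishes m c : Prop := forall j : int, (`|j| < m)%N -> c j = 0.

Lemma vanishes0 m : vanishes m 0.
Proof. by []. Qed.

Lemma vanishesB m c c' : vanishes m c -> vanishes m c' -> vanishes m (c - c').
Proof.
by move=> c0 c'0 j jm; rewrite -[LHS]/(c j - c' j) c0// c'0// subr0.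
Qed.

Lemma vanishes_le m m' c : (m <= m')%N -> vanishes m' c -> vanishes m c.
Proof. by move=> mm' c0 j jm; apply: c0; exact: leq_trans jm mm'. Qed.

(** Continuity at 0: counterexamples [u n] vanishing on ever larger windows would tend to 0, hence
    so would their images. *)
Lemma gca_local (F : gca G) m :
  exists m', forall c, vanishes m' c -> vanishes m (F c).
Proof.
apply: contrapT => /forallNP H.
have {}H m' : exists c, vanishes m' c /\ ~ vanishes m (F c).
  by have /existsNP[c /not_implyP] := H m'; exists c.
have [u uP] := choice H.
have u0 : u @ \oo --> (0 : config G).
  apply/cvg_configP => i.
  suff: \forall n \near \oo, u n i = 0 by [].
  by exists `|i|.+1 => // n /= ni; apply: (uP n).1.
have Fu0 : (F \o u) @ \oo --> (0 : config G).
  rewrite -[0](raddf0 F); apply: cvg_comp u0 _; exact: gca_continuous.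
have Fu0i := (cvg_configP _ _).1 Fu0.
(* The cells with |j| < m are among the finitely many k - m with k < 2m, so pointwise convergence
   becomes uniform on the window. *)
have : \forall n \near \oo, forall k : 'I_(m.*2), F (u n) (k%:Z - m%:Z) = 0.
  by apply: filter_forall => k; exact: Fu0i.
case=> N _ /(_ N (leqnn N)) FN; apply: (uP N).2 => j jm.
have [j0 j1] : 0 <= j + m%:Z /\ j + m%:Z < m.*2%:Z.
  move: jm; rewrite -ltz_nat abszE ltr_norml => /andP[/ltW j0 j1]; split.
    by rewrite -lerBlDr sub0r.
  by rewrite -addnn PoszD ltrD2r.
have jlt : (`|(j + m%:Z)%R| < m.*2)%N by rewrite -ltz_nat gez0_abs.
by rewrite -(FN (Ordinal jlt)) /= gez0_abs// addrK.
Qed.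

(** If the disagreement nearest to 0 has absolute index n, then 2^-n > 2^-m means n < m; this is why
    windows are cut out by a strict inequality. *)
Lemma config_dist_gt (R : realType) m c c' :
  config_dist R c c' > 2 ^- m <-> ~ vanishes m (c - c').
Proof.
rewrite /config_dist; case: pselect => [->|cc'].
  rewrite subrr; split=> [|/(_ (@vanishes0 m))//].
  by rewrite invr_lt0 ltNge exprn_ge0.
case: ex_minnP => n /asboolP[j jn cj] nmin.
rewrite ltf_pV2 ?posrE ?exprn_gt0// ltr_eXn2l ?ltr1n//; split=> [nm v|].
  by move/eqP: cj; apply; apply/eqP; rewrite -subr_eq0 -[_ - _]/((c - c') j) v// jn.
apply: contra_notT; rewrite -leqNgt => mn i im.
apply/eqP; rewrite subr_eq0; apply: contraT => ci.
have : `[< exists2 k : int, `|k|%N = `|i|%N & c k != c' k >].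
  by apply/asboolP; exists i.
by move=> /nmin; rewrite leqNgt (leq_trans im mn).
Qed.

(** Additivity reduces a pair c, c' to c - c' and 0, and [eps] may be traded for a power 2^-m. The
    index type is free so that both two-sided and forward orbits are covered. *)
Lemma expansive_familyP (R : realType) (I : Type)
    (f : I -> config G -> config G) :
    (forall n, zmod_morphism (f n)) ->
  (exists2 eps : R, 0 < eps & forall c c', c <> c' ->
     exists n, config_dist R (f n c) (f n c') > eps) <->
  (exists m, forall c, (forall n, vanishes m (f n c)) -> c = 0).
Proof.
move=> fB; have f0 n : f n 0 = 0 by rewrite -[X in f n X](subrr 0) fB subrr.
split=> [[eps eps0 epsP]|[m mP]]; last first.
  exists (2 ^- m); first by rewrite invr_gt0 exprn_gt0.
  move=> c c' cc'; apply: contrapT => /forallNP H; apply: cc'.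
  apply/eqP; rewrite -subr_eq0; apply/eqP/mP => n; rewrite fB.
  by apply: contrapT => /(config_dist_gt R); exact: H.
have [m mP] : exists m, (2 ^- m : R) < eps.
  have [m _ mP] : \forall k \near \oo, eps^-1 < 2 ^+ k :> R.
    near=> k; apply: (@lt_trans _ _ k%:R); last by rewrite -natrX ltr_nat ltn_expl.
    by near: k; exact: nbhs_infty_gtr.
  exists m; rewrite -[ltRHS]invrK ltf_pV2 ?posrE ?exprn_gt0 ?invr_gt0//.
  exact: mP (leqnn m).
exists m => c cv; apply: contrapT => /epsP[n].
move=> /(lt_trans mP) /config_dist_gt; rewrite f0 subr0; apply; exact: cv.
Unshelve. all: by end_near. Qed.

Lemma iter_zmod_morphism (f : {additive config G -> config G}) n :
  zmod_morphism (iter n f).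
Proof. by elim: n => // n IH c c'; rewrite !iterS IH raddfB. Qed.

Section Injective.
Variables (F : gca G) (Finj : injective F).
Let Fi := gca_inv Finj.
Let H := gca_sub F Fi.

Let FiK : cancel Fi F. Proof. exact: gca_invK. Qed.
Let FK : cancel F Fi. Proof. exact: gcaK. Qed.

Lemma gca_iterz_zmod_morphism n : zmod_morphism (gca_iterz Finj n).
Proof. by case: n => k; exact: iter_zmod_morphism. Qed.

Lemma gca_iterz_F n c : gca_iterz Finj n (F c) = gca_iterz Finj (n + 1) c.
Proof.
case: n => [k|[|k]] /=; first by rewrite addn1 -iterSr.
  exact: FK.
by rewrite -iterS iterSr FK subn1.
Qed.

Lemma gca_iterz_inv n c : gca_iterz Finj n (Fi c) = gca_iterz Finj (n - 1) c.
Proof. by rewrite -{2}(FiK c) gca_iterz_F subrK. Qed.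

Lemma gca_iterz_ind (P : config G -> Prop) :
    (forall c, P c -> P (F c)) -> (forall c, P c -> P (Fi c)) ->
  forall n c, P c -> P (gca_iterz Finj n c).
Proof.
move=> PF PFi [k|k] c Pc; rewrite /gca_iterz.
  by elim: k => //= k; exact: PF.
by elim: k.+1 => //= l; exact: PFi.
Qed.

(** [H] commutes with [Fi], so locality of [Fi] can be applied along a whole [H]-orbit. *)
Lemma iter_gca_sub_inv n c : iter n H (Fi c) = Fi (iter n H c).
Proof. by elim: n => //= n ->; rewrite raddfB FK FiK. Qed.

Lemma vanishes_gca_sub m c : (forall n, vanishes m (gca_iterz Finj n c)) ->
  forall n, vanishes m (iter n H c).
Proof.
move=> cv n.
(* The induction needs the whole [F]-orbit of H^n c, because F^k H = F^(k+1) - F^(k-1). *)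
suff: forall k, vanishes m (gca_iterz Finj k (iter n H c)) by move/(_ 0).
elim: n => //= n IH k.
rewrite gca_iterz_zmod_morphism gca_iterz_F gca_iterz_inv.
by apply: vanishesB; exact: IH.
Qed.

Lemma vanishes_gca_iterz m c :
    (forall n, vanishes m (iter n H c)) ->
    (forall n, vanishes m (iter n H (Fi c))) ->
  forall n, vanishes m (gca_iterz Finj n c).
Proof.
pose A := [set c | forall n, vanishes m (iter n H c)].
have AB x y : A x -> A y -> A (x - y).
  by move=> Ax Ay n; rewrite iter_zmod_morphism; apply: vanishesB.
have AH x : A x -> A (H x) by move=> Ax n; rewrite -iterSr; exact: Ax.
have A0 : A 0 by move=> n; rewrite -(subrr 0) iter_zmod_morphism subrr.
(* [A] alone need not be stable under [F], but the set of x with both x and [Fi x] in [A] is stable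
   under [F] and [Fi]. *)
move=> Ac AFic n; suff [/(_ 0%N)] : (A `&` Fi @^-1` A) (gca_iterz Finj n c) by [].
apply: gca_iterz_ind => // x [Ax AFix]; split=> //=.
- have -> : F x = H x - (0 - Fi x) by rewrite sub0r opprK subrK.
  by apply: (AB); [exact: AH|exact: AB].
- by rewrite FK.
- have -> : Fi (Fi x) = x - H (Fi x) by rewrite /= FiK subKr.
  by apply: AB => //; exact: AH.
Qed.

End Injective.
End Windows.

Theorem theorem2 (R : realType) (G : finZmodType) (F : gca G)
    (Finj : injective F) :
  let H := gca_sub F (gca_inv Finj) in
  expansive R Finj <-> positively_expansive R H.
Proof.
move=> H.
have FP := expansive_familyP R (@gca_iterz_zmod_morphism G F Finj).
have HP := expansive_familyP R (iter_zmod_morphism H).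
split=> [/FP[m mP]|/HP[m mP]].
- have [m' m'P] := gca_local (gca_inv Finj) m.
  apply/HP; exists (maxn m m') => c cv; apply: mP.
  apply: vanishes_gca_iterz => n.
    by apply: vanishes_le (cv n); exact: leq_maxl.
  rewrite iter_gca_sub_inv; apply: m'P.
  by apply: vanishes_le (cv n); exact: leq_maxr.
(* In this direction the window need not grow. *)
- apply/FP; exists m => c cv; apply: mP.
  exact: vanishes_gca_sub.
Qed.
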